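(* Let $IS\in\{\Box,\blacksquare\}^2$ be an initial store with two elements, and let $\tau:\mathrm{SYNCSIMPLE}\to\mathrm{LOCKSIMPLE}_{2,IS}$ be a compositional translation. Then $\tau$ is not correct.
   Context: SYNCSIMPLE. Subprocesses are given by $\mathcal U ::= \checkmark \mid 0 \mid\ !\mathcal U \mid\ ?\mathcal U$, and processes are finite parallel compositions $\mathcal U_1 | \cdots | \mathcal U_n$ ($n\ge 1$), where $|$ is associative and commutative with identity element $0$ (so a process is a finite multiset of subprocesses). One step: $!\mathcal U_1 | ?\mathcal U_2 | \mathcal P \to \mathcal U_1 | \mathcal U_2 | \mathcal P$ for subprocesses $\mathcal U_1,\mathcal U_2$ and any process $\mathcal P$. A process is successful if it has the form $\checkmark | \mathcal P$. LOCKSIMPLE$_{k,IS}$ ($k\ge1$, $IS\in\{\Box,\blacksquare\}^k$; $\Box$ = empty, $\blacksquare$ = full). Subprocesses: $\mathcal U ::= \checkmark \mid 0 \mid P_i\,\mathcal U \mid T_i\,\mathcal U$ with $i\in\{1,\dots,k\}$; processes are finite parallel compositions (multisets) of subprocesses as before. States are pairs $(\mathcal P,(C_1,\dots,C_k))$ with $C_i\in\{\Box,\blacksquare\}$. Steps: $(P_i\mathcal U | \mathcal P,\mathcal C)\to(\mathcal U|\mathcal P,\mathcal C[C_i\mapsto\blacksquare])$ allowed only if $C_i=\Box$ in $\mathcal C$ (otherwise $P_i$ waits); $(T_i\mathcal U|\mathcal P,\mathcal C)\to(\mathcal U|\mathcal P,\mathcal C[C_i\mapsto\Box])$ always allowed.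 A state is successful if its process has the form $\checkmark|\mathcal P$. Convergence (for SYNCSIMPLE processes, and for LOCKSIMPLE states). With $\to^*$ the reflexive-transitive closure of the step relation: an element is may-convergent if it reduces by $\to^*$ to a successful one; must-convergent if everything reachable from it by $\to^*$ is may-convergent. A LOCKSIMPLE$_{k,IS}$ process $\mathcal P$ has one of these properties iff the state $(\mathcal P,IS)$ has it. Translations. A translation is a map $\tau$ from SYNCSIMPLE processes to LOCKSIMPLE$_{k,IS}$ processes. It is compositional if there are finite strings $\tau(!),\tau(?)$ over $\{P_1,T_1,\dots,P_k,T_k\}$ such that $\tau(0)=0$, $\tau(\checkmark)=\checkmark$, $\tau(!\mathcal U)=\tau(!)\tau(\mathcal U)$, $\tau(?\mathcal U)=\tau(?)\tau(\mathcal U)$, and $\tau(\mathcal P_1|\mathcal P_2)=\tau(\mathcal P_1)|\tau(\mathcal P_2)$. It is correct if for all SYNCSIMPLE processes $\mathcal P$: $\mathcal P$ is may-convergent iff $\tau(\mathcal P)$ is, and $\mathcal P$ is must-convergent iff $\tau(\mathcal P)$ is. *)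

(* Defs.v *)
From HB Require Import structures.
From mathcomp Require Import all_boot finmap multiset.
From Stdlib Require Import Relation_Operators.

Set Implicit Arguments.
Unset Strict Implicit.
Unset Printing Implicit Defensive.

Local Open Scope mset_scope.

(* Subprocesses over a set A of prefixes; both calculi are instances. *)
Inductive subproc (A : Type) : Type :=
  | Tick
  | Nil
  | Act of A & subproc A.
Arguments Tick {A}.
Arguments Nil {A}.

(* A subprocess is a word of prefixes and a final symbol (true for Tick). *)
Fixpoint subproc_code (A : Type) (U : subproc A) : seq A * bool :=
  match U with
  | Tick => ([::], true)
  | Nil => ([::], false)
  | Act a V => let c := subproc_code V in (a :: c.1, c.2)
  end.

Definition subproc_decode (A : Type) (c : seq A * bool) : subproc A :=
  foldr (@Act A) (if c.2 then Tick else Nil) c.1.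

Lemma subproc_codeK (A : Type) :
  cancel (@subproc_code A) (@subproc_decode A).
Proof.
by elim=> [||a U IH] //=; rewrite /subproc_decode /= -/(subproc_decode _) IH.
Qed.

HB.instance Definition _ (A : eqType) :=
  Equality.copy (subproc A) (can_type (@subproc_codeK A)).
HB.instance Definition _ (A : choiceType) :=
  Choice.copy (subproc A) (can_type (@subproc_codeK A)).

(* Processes are taken up to associativity, commutativity and the identity
   law for 0: they are finite multisets of subprocesses other than 0, and the
   subprocess 0, viewed as a process, is the empty multiset. *)
Definition nzsub (A : choiceType) := {U : subproc A | U != Nil}.
Definition proc (A : choiceType) := {mset (nzsub A)}.

Definition proc_of (A : choiceType) (U : subproc A) : proc A :=
  if insub U is Some V then [mset V : nzsub A] else mset0.
Coercion proc_of : subproc >-> proc.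

Definition par (A : choiceType) (P Q : proc A) : proc A := P `+` Q.
Notation "P ||| Q" := (par P Q) (at level 50, left associativity).

Definition successful (A : choiceType) (P : proc A) : Prop :=
  exists Q : proc A, P = Tick ||| Q.

Section Convergence.
Variables (S : Type) (step : S -> S -> Prop) (success : S -> Prop).

Definition may_convergent (x : S) : Prop :=
  exists y, clos_refl_trans S step x y /\ success y.

Definition must_convergent (x : S) : Prop :=
  forall y, clos_refl_trans S step x y -> may_convergent y.
End Convergence.

(* SYNCSIMPLE: Send is the prefix !, Recv is the prefix ?. *)
Inductive sync_act : Type := Send | Recv.

Definition sync_act_code (a : sync_act) : bool :=
  if a is Send then true else false.
Definition sync_act_decode (b : bool) : sync_act := if b then Send else Recv.
Lemma sync_act_codeK : cancel sync_act_code sync_act_decode.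
Proof. by case. Qed.
HB.instance Definition _ := Choice.copy sync_act (can_type sync_act_codeK).

Notation sync_proc := (proc sync_act).

Inductive sync_step : sync_proc -> sync_proc -> Prop :=
  | SyncStep (U1 U2 : subproc sync_act) (P : sync_proc) :
      sync_step (Act Send U1 ||| Act Recv U2 ||| P) (U1 ||| U2 ||| P).

Definition sync_may : sync_proc -> Prop :=
  may_convergent sync_step (@successful sync_act).
Definition sync_must : sync_proc -> Prop :=
  must_convergent sync_step (@successful sync_act).

(* LOCKSIMPLE: Put i is P_i, Take i is T_i, with indices 0 .. k-1. *)
Inductive lock_act (k : nat) : Type := Put of 'I_k | Take of 'I_k.

Definition lock_act_code (k : nat) (a : lock_act k) : 'I_k + 'I_k :=
  match a with Put i => inl i | Take i => inr i end.
Definition lock_act_decode (k : nat) (s : 'I_k + 'I_k) : lock_act k :=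
  match s with inl i => Put i | inr i => Take i end.
Lemma lock_act_codeK (k : nat) :
  cancel (@lock_act_code k) (@lock_act_decode k).
Proof. by case. Qed.
HB.instance Definition _ (k : nat) :=
  Choice.copy (lock_act k) (can_type (@lock_act_codeK k)).

Notation lock_proc k := (proc (lock_act k)).

(* A cell is true when full and false when empty. *)
Definition store (k : nat) : Type := {ffun 'I_k -> bool}.

Definition set_cell (k : nat) (C : store k) (i : 'I_k) (b : bool) : store k :=
  [ffun j => if j == i then b else C j].

Definition lock_state (k : nat) : Type := (lock_proc k * store k)%type.

Inductive lock_step (k : nat) : lock_state k -> lock_state k -> Prop :=
  | PutStep (i : 'I_k) (U : subproc (lock_act k)) (P : lock_proc k)
      (C : store k) :
      C i = false ->
      lock_step (Act (Put i) U ||| P, C) (U ||| P, set_cell C i true)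
  | TakeStep (i : 'I_k) (U : subproc (lock_act k)) (P : lock_proc k)
      (C : store k) :
      lock_step (Act (Take i) U ||| P, C) (U ||| P, set_cell C i false).

Definition lock_successful (k : nat) (s : lock_state k) : Prop :=
  successful s.1.

Definition lock_may (k : nat) (IS : store k) (P : lock_proc k) : Prop :=
  may_convergent (@lock_step k) (@lock_successful k) (P, IS).
Definition lock_must (k : nat) (IS : store k) (P : lock_proc k) : Prop :=
  must_convergent (@lock_step k) (@lock_successful k) (P, IS).

Definition prepend (A : Type) (w : seq A) (U : subproc A) : subproc A :=
  foldr (@Act A) U w.

(* ws and wr are the strings tau(!) and tau(?).  The map t is tau on
   subprocesses: writing tau(!) tau(U) presupposes that tau(U) is again a
   subprocess, and t U is determined by tau because proc_of is injective. *)
Definition compositional (k : nat) (tau : sync_proc -> lock_proc k) : Prop :=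
  exists (ws wr : seq (lock_act k))
         (t : subproc sync_act -> subproc (lock_act k)),
    (forall U : subproc sync_act, tau U = t U) /\
    t Nil = Nil /\
    t Tick = Tick /\
    (forall U, t (Act Send U) = prepend ws (t U)) /\
    (forall U, t (Act Recv U) = prepend wr (t U)) /\
    (forall P Q : sync_proc, tau (P ||| Q) = tau P ||| tau Q).

Definition correct (k : nat) (IS : store k) (tau : sync_proc -> lock_proc k) :
    Prop :=
  forall P : sync_proc,
    (sync_may P <-> lock_may IS (tau P)) /\
    (sync_must P <-> lock_must IS (tau P)).

(* Main.v *)
(* Let s and r be the images of ! and ?.  Since !✓ and ?✓ are not
   may-convergent, s and r run alone from IS block, on locks i and j.

   The key observation is that s, started alone from the store where only lock
   i is empty, cannot block on i: otherwise, in (!✓)^n | ?0 with n large, one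
   lets a new copy of s run whenever r empties lock i; it fills i again and
   gets stuck, and finally no copy of s completes, although (!✓)^n | ?0 is
   must-convergent.  The same holds for r and j.

   If i = j, a deadlock of s | r is reachable, and if i <> j the observation
   leaves only the store where both locks are empty, where s | r again
   deadlocks, and the one where both are full.  In the latter case let s1 and
   r1 be the parts of s and r before the blocking Put, so that s1 does not use
   i and r1 does not use j.  Up to symmetry r1 leaves i empty.  After r1, the
   whole of s must run without r, and then the rest q of r.  If this leaves j
   empty, then r can run once more, so that !0 | ??✓ is may-convergent in the
   target; if it leaves i empty and j full, then s can run once more, which
   does the same for !!✓ | ?0; and if it leaves both full, then in two copies
   of s | r one can run s1, r1, r1 and then the other s and one q, after which
   the remaining s and r are in a deadlock. *)
From Pilot Require (* [Defs.Nil] was shadowed by [seq.Nil]. *)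
Import Defs.
From mathcomp Require Import all_boot finmap multiset.
From Stdlib Require Import Relation_Operators Operators_Properties.

(* [Defs.Nil] was shadowed by [seq.Nil]. *)
Import Defs.

Set Implicit Arguments.
Unset Strict Implicit.
Unset Printing Implicit Defensive.

(** * Processes as lists of subprocesses up to permutation *)

Section Procs.
Variable A : choiceType.
Implicit Types (U V : subproc A) (L : seq (subproc A)) (P Q : proc A).

Lemma parC P Q : P ||| Q = Q ||| P.
Proof. exact: msetDC. Qed.

Lemma parA P Q R : P ||| (Q ||| R) = P ||| Q ||| R.
Proof. exact: msetDA. Qed.

Lemma parCA P Q R : P ||| (Q ||| R) = Q ||| (P ||| R).
Proof. exact: msetDCA. Qed.

Lemma par_inj P : injective (par P).
Proof. exact: can_inj (msetDKB P). Qed.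

(** Lists keep the individual subprocesses in view; a 0 may stay in the list although it vanishes in
    the multiset. *)
Definition procs L : proc A := foldr (fun U P => U ||| P) mset0 L.

Lemma procs_cat L1 L2 : procs (L1 ++ L2) = procs L1 ||| procs L2.
Proof.
elim: L1 => [|U L1 IH] /=; first by rewrite /par mset0D.
by rewrite IH parA.
Qed.

Lemma proc_of_Nil : proc_of (@Nil A) = mset0.
Proof. by rewrite /proc_of insubN ?eqxx. Qed.

Lemma par_Nil P : (@Nil A) ||| P = P.
Proof. by rewrite proc_of_Nil /par mset0D. Qed.

Lemma procs_mid L1 U L2 : procs (L1 ++ U :: L2) = U ||| procs (L1 ++ L2).
Proof. by rewrite !procs_cat /= parCA. Qed.

Lemma procs_perm L1 L2 : perm_eq L1 L2 -> procs L1 = procs L2.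
Proof.
elim: L1 L2 => [|U L1 IH] L2; first by rewrite perm_sym => /perm_nilP ->.
move=> eqL; have UL2 : U \in L2 by rewrite -(perm_mem eqL) mem_head.
case/splitPr: UL2 eqL => p1 p2.
rewrite -(cat1s U p2) perm_sym perm_catCA perm_cons perm_sym.
by move=> eqL; rewrite procs_mid /= (IH (p1 ++ p2)).
Qed.

Lemma proc_of_nz U (nzU : U != Nil) : proc_of U = [mset (exist _ U nzU : nzsub A)]%mset.
Proof. by rewrite /proc_of insubT. Qed.

Lemma in_procs (u : nzsub A) L : u \in procs L -> val u \in L.
Proof.
elim: L => [|U L IH] /=; first by rewrite in_mset0.
rewrite /par in_msetD inE => /orP[|/IH -> //]; last by rewrite orbT.
case: (eqVneq U Nil) => [->|nzU]; first by rewrite proc_of_Nil in_mset0.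
by rewrite proc_of_nz in_mset1 => /eqP -> /=; rewrite eqxx.
Qed.

Lemma procs_inv L U P : U != Nil -> procs L = U ||| P ->
  exists2 L', perm_eq L (U :: L') & P = procs L'.
Proof.
move=> nzU eqL; have UL : U \in L.
  apply: (@in_procs (exist _ U nzU : nzsub A)).
  by rewrite eqL /par in_msetD proc_of_nz in_mset1 eqxx.
exists (rem U L); first exact: perm_to_rem.
apply: (@par_inj U).
by rewrite -eqL (procs_perm (perm_to_rem UL)).
Qed.

Lemma successful_procs L : successful (procs L) <-> Tick \in L.
Proof.
split=> [[Q eqL]|]; last first.
  by case/splitPr=> L1 L2; exists (procs (L1 ++ L2)); apply: procs_mid.
by case: (procs_inv _ eqL) => // L' /perm_mem -> _; rewrite mem_head.
Qed.

End Procs.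

(** * Unfolding may- and must-convergence by one step *)

Section Convergence.
Variables (S : Type) (step : S -> S -> Prop) (success : S -> Prop).
Local Notation steps := (clos_refl_trans S step).
Local Notation may := (may_convergent step success).
Local Notation must := (must_convergent step success).

Lemma rt_inv x y : steps x y -> x = y \/ exists2 z, step x z & steps z y.
Proof.
move/(@clos_rt_rt1n _ _ _ _); case=> [|z w xz zw]; first by left.
by right; exists z => //; apply: clos_rt1n_rt.
Qed.

Lemma may_inv x : may x -> success x \/ exists2 y, step x y & may y.
Proof.
case=> z [/rt_inv[<-|[y xy yz]] sz]; first by left.
by right; exists y => //; exists z.
Qed.

Lemma may_success x : success x -> may x.
Proof. by exists x; split=> //; apply: rt_refl. Qed.

Lemma may_step x y : step x y -> may y -> may x.
Proof.
move=> xy [z [yz sz]]; exists z; split=> //.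
by apply: rt_trans yz; apply: rt_step.
Qed.

Lemma must_next x :
  (exists y, step x y) -> (forall y, step x y -> must y) -> must x.
Proof.
move=> [y xy] mustS z /rt_inv[<-|[y' xy' y'z]]; last exact: (mustS _ xy').
by apply: (may_step xy); apply: (mustS _ xy); apply: rt_refl.
Qed.

End Convergence.

(** * Convergence of the test processes in SYNCSIMPLE *)

Definition dual (a : sync_act) := if a is Send then Recv else Send.

Section Sync.
Implicit Types (a : sync_act) (U V : subproc sync_act) (L : seq (subproc sync_act)).

Lemma sync_step_inv a L Q : sync_step (procs L) Q ->
  exists U V L', perm_eq L (Act a U :: Act (dual a) V :: L') /\
                 Q = procs (U :: V :: L').
Proof.
move=> step; move: {-2}(procs L) (erefl (procs L)) step => P0 eqP step.
case: step eqP => U1 U2 P; rewrite -parA => eqP.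
have [//|L1 eqL1 eqP1] := procs_inv _ (esym eqP).
have [//|L2 eqL2 eqP2] := procs_inv _ (esym eqP1).
have eqL : perm_eq L (Act Send U1 :: Act Recv U2 :: L2).
  by apply: perm_trans eqL1 _; rewrite perm_cons.
case: a; first by exists U1, U2, L2; rewrite eqP2 /= parA.
exists U2, U1, L2; split; last by rewrite eqP2 /= -parA parCA.
by apply: perm_trans eqL _; rewrite (perm_catCA [:: _] [:: _]).
Qed.

Lemma sync_step_ex a U V L :
  sync_step (procs (Act a U :: Act (dual a) V :: L)) (procs (U :: V :: L)).
Proof.
have := SyncStep; case: a => /= step; rewrite parA; first by rewrite parA; apply: step.
by rewrite [_ ||| proc_of (Act Send V)]parC parA [U ||| _]parC; apply: step.
Qed.

Lemma sync_must_tick L : Tick \in L -> sync_must (procs L).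
Proof.
move=> tickL Q stepsQ; apply: may_success.
suff [L' -> tickL'] : exists2 L', Q = procs L' & Tick \in L' by apply/successful_procs.
move/(@clos_rt_rtn1 _ _ _ _): stepsQ; elim=> [|Q1 Q2 step _ [L1 eqQ1 tick1]].
  by exists L.
move: step; rewrite eqQ1 => /(sync_step_inv Send)[U [V [L2 [/perm_mem eqL ->]]]].
exists [:: U, V & L2] => //.
by move: tick1; rewrite eqL !inE => /= ->; rewrite !orbT.
Qed.

Lemma sync_must_next a U V L :
    (forall U' V' L', perm_eq (Act a U :: Act (dual a) V :: L) 
                              (Act a U' :: Act (dual a) V' :: L') ->
       sync_must (procs (U' :: V' :: L'))) ->
  sync_must (procs (Act a U :: Act (dual a) V :: L)).
Proof.
move=> mustS; apply: must_next => [|Q]; first by eexists; exact: sync_step_ex.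
by move/(sync_step_inv a) => [U' [V' [L' [eqL ->]]]]; apply: mustS.
Qed.

Lemma sync_next_not_may a L : Tick \notin L ->
  (forall U V L', perm_eq L (Act a U :: Act (dual a) V :: L') ->
     ~ sync_may (procs (U :: V :: L'))) ->
  ~ sync_may (procs L).
Proof.
move=> ntick nmay mayL.
case: (may_inv mayL) => [/successful_procs|[Q]]; first by rewrite (negPf ntick).
by move/(sync_step_inv a) => [U [V [L' [eqL ->]]]]; apply: nmay.
Qed.

Lemma sync_single_not_may a U : ~ sync_may (procs [:: Act a U]).
Proof.
apply: (@sync_next_not_may a) => // V W L'.
by move/perm_size.
Qed.

(** Only one communication is possible, and it leaves a guarded tick without a partner. *)
Lemma sync_double_not_may a : 
  ~ sync_may (procs [:: Act a (Act a Tick); Act (dual a) Nil]).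
Proof.
apply: (@sync_next_not_may a) => // U V L eqL.
have /eqP/size0nil L0 : size L == 0 by move/perm_size: eqL => /= [] <-.
rewrite L0 in eqL *.
have : Act a U \in [:: Act a (Act a Tick); Act (dual a) Nil].
  by rewrite (perm_mem eqL) mem_head.
have : Act (dual a) V \in [:: Act a (Act a Tick); Act (dual a) Nil].
  by rewrite (perm_mem eqL) !inE eqxx orbT.
rewrite !inE => /orP[/eqP[]|/eqP[->]]; first by case: (a).
move=> /orP[/eqP[->]|/eqP[]]; last by case: (a).
have ->: procs [:: Act a Tick; Nil] = procs [:: Act a Tick].
  by rewrite /= par_Nil.
exact: sync_single_not_may.
Qed.

Lemma sync_must_all_tick a V L :
    (forall U, Act a U \in Act (dual a) V :: L -> U = Tick) ->
  sync_must (procs (Act a Tick :: Act (dual a) V :: L)).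
Proof.
move=> tickL; apply: sync_must_next => U W L' eqL; apply: sync_must_tick.
suff -> : U = Tick by rewrite mem_head.
have : Act a U \in Act a Tick :: Act (dual a) V :: L by rewrite (perm_mem eqL) mem_head.
by rewrite in_cons => /orP[/eqP[]|/tickL].
Qed.

Lemma sync_must_nseq a n :
  sync_must (procs (Act (dual a) Nil :: nseq n.+1 (Act a Tick))).
Proof.
rewrite (@procs_perm _ _ (Act a Tick :: Act (dual a) Nil :: nseq n (Act a Tick))); last first.
  by rewrite /= (perm_catCA [:: _] [:: _]).
apply: sync_must_all_tick => U.
rewrite inE mem_nseq => /orP[/eqP[]|/andP[_ /eqP[]]] //; by case: (a).
Qed.

(** A first communication either exposes a tick or consumes both subprocesses ending in 0; the
    remaining pair then exposes its ticks. *)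
Lemma sync_must_two_pairs a :
  sync_must (procs [:: Act a Nil; Act a Tick; Act (dual a) Nil; Act (dual a) Tick]).
Proof.
set L0 := [:: _; _; _; _].
have eqL0 : perm_eq L0 [:: Act a Nil; Act (dual a) Nil; Act a Tick; Act (dual a) Tick].
  by rewrite /L0 perm_cons (perm_catCA [:: _] [:: _]).
rewrite (procs_perm eqL0).
apply: sync_must_next => U V L; rewrite -(permPl eqL0) => eqL.
have : Act a U \in L0 by rewrite (perm_mem eqL) mem_head.
have : Act (dual a) V \in L0 by rewrite (perm_mem eqL) !inE eqxx orbT.
rewrite !inE => /or4P[]/eqP[]; try by case: (a).
- move=> eqV /or4P[]/eqP[]; try by case: (a).
  + move=> eqU; move: eqL; rewrite eqU eqV (permPl eqL0) !perm_cons => eqL.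
    rewrite /= -(procs_perm eqL) !par_Nil.
    apply: sync_must_all_tick => W; rewrite inE => /eqP[]; by case: (a).
  + by move=> -> ; apply: sync_must_tick; rewrite mem_head.
- by move=> -> _; apply: sync_must_tick; rewrite !inE eqxx orbT.
Qed.

End Sync.

(** * Running a word of lock actions alone *)

Section Exec.
Variable k : nat.
Implicit Types (C D : store k) (w u v : seq (lock_act k)) (i j l : 'I_k).
Implicit Types (U V : subproc (lock_act k)) (L : seq (subproc (lock_act k))).

Fixpoint exec C w : option (store k) :=
  match w with
  | [::] => Some C
  | Put i :: w' => if C i then None else exec (set_cell C i true) w'
  | Take i :: w' => exec (set_cell C i false) w'
  end.

Definition lock_of (a : lock_act k) := match a with Put i => i | Take i => i end.

Definition touches l w := l \in map lock_of w.

Definition blocked_on l C w : Prop :=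
  exists u v C', [/\ w = u ++ Put l :: v, exec C u = Some C' & C' l].

Lemma exec_cat C u v : exec C (u ++ v) = obind (exec^~ v) (exec C u).
Proof. by elim: u C => [|[i|i] u IH] C //=; case: ifP. Qed.

Lemma execP C w : (exists C', exec C w = Some C') \/ exists l, blocked_on l C w.
Proof.
elim: w C => [|a w IH] C; first by left; exists C.
have step C' : (forall u, exec C (a :: u) = exec C' u) ->
  (exists C', exec C (a :: w) = Some C') \/ exists l, blocked_on l C (a :: w).
  move=> eqC; case: (IH C') => [[C2 C2P]|[l [u [v [C2 [-> C2P C2l]]]]]].
    by left; exists C2; rewrite eqC.
  by right; exists l, (a :: u), v, C2; split=> //; rewrite eqC.
case: a step => i step; last exact: (step (set_cell C i false)).
case Ci: (C i); last by apply: (step (set_cell C i true)) => u /=; rewrite Ci.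
by right; exists i, [::], w, C.
Qed.

Lemma blocked_not_exec l C w C' : blocked_on l C w -> exec C w <> Some C'.
Proof.
by case=> u [v [C1 [-> C1P C1l]]]; rewrite exec_cat C1P /= C1l.
Qed.

Lemma blocked_uniq l m C w : blocked_on l C w -> blocked_on m C w -> l = m.
Proof.
case=> u1 [v1 [C1 [-> C1P C1l]]] [u2 [v2 [C2 []]]].
elim: u1 u2 C C1P => [|a u1 IH] [|b u2] C /=.
- by move=> _ [->].
- move=> [->] [<- _] /=; by rewrite C1l.
- move=> + [eqa _] [eqC] C2m; rewrite eqa /= eqC C2m //.
by move=> + [<- equ]; case: a => i /=; [case: (C i) => //|]; move=> C1P; apply: IH.
Qed.

(** The last action of [w] on a lock decides its final content, whatever the initial store. *)
Lemma exec_cells C D w C' D' : exec C w = Some C' -> exec D w = Some D' ->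
  forall l, D' l = if touches l w then C' l else D l.
Proof.
elim: w C D C' D' => [|a w IH] C D C' D' /=; first by move=> _ [->].
have step b : exec (set_cell C (lock_of a) b) w = Some C' ->
    exec (set_cell D (lock_of a) b) w = Some D' ->
  forall l, D' l = if touches l (a :: w) then C' l else D l.
  move=> execC execD l; rewrite (IH _ _ _ _ execC execD) /touches in_cons !ffunE.
  case: eqP => [->|_] //=; case: ifP => // ntouch.
  by rewrite (IH _ _ _ _ execC execC) /touches ntouch ffunE eqxx.
by case: a step => i step; [case: (C i) (D i) => [] []//|]; apply: step.
Qed.

Lemma exec_untouched C w C' l : exec C w = Some C' -> ~~ touches l w -> C' l = C l.
Proof. by move=> execC /negPf ntouch; rewrite (exec_cells execC execC) ntouch. Qed.

(** Only a [Put] on a full lock waits, so starting with more locks empty cannot stop a run. *)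
Lemma exec_mono C D w C' : (forall l, D l -> C l) -> exec C w = Some C' ->
  exists D', exec D w = Some D'.
Proof.
elim: w C D => [|a w IH] C D leDC; first by eexists.
have leS l b : forall m, set_cell D l b m -> set_cell C l b m.
  by move=> m; rewrite !ffunE; case: ifP => // _; apply: leDC.
case: a => i /=; last by apply: IH; apply: leS.
case Ci: (C i) => //; have /negPf-> : ~~ D i by apply/negP=> /leDC; rewrite Ci.
by apply: IH; apply: leS.
Qed.

Lemma touches_cat l u v : touches l (u ++ v) = touches l u || touches l v.
Proof. by rewrite /touches map_cat mem_cat. Qed.

Definition reach L C L' C' :=
  clos_refl_trans _ (@lock_step k) (procs L, C) (procs L', C').

Lemma reach_trans L2 C2 L1 C1 L3 C3 :
  reach L1 C1 L2 C2 -> reach L2 C2 L3 C3 -> reach L1 C1 L3 C3.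
Proof. exact: rt_trans. Qed.

Lemma prepend_cat u v U : prepend (u ++ v) U = prepend u (prepend v U).
Proof. by rewrite /prepend foldr_cat. Qed.

Lemma reach_exec L1 L2 w U C C' : exec C w = Some C' ->
  reach (L1 ++ prepend w U :: L2) C (L1 ++ U :: L2) C'.
Proof.
rewrite /reach !procs_mid; elim: w C => [|a w IH] C /=; first by case=> ->; apply: rt_refl.
case: a => i; [case Ci: (C i) => //|] => execC; apply: rt_trans (IH _ execC).
  by apply: rt_step; apply: PutStep.
by apply: rt_step; apply: TakeStep.
Qed.

(** The subprocesses that neither step in [C] nor give success; 0 is among them because lists may
    contain it. *)
Definition waiting C U :=
  match U with Nil => true | Act (Put l) _ => C l | _ => false end.

Lemma waiting_not_may L C : all (waiting C) L ->
  ~ may_convergent (@lock_step k) (@lock_successful k) (procs L, C).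
Proof.
move=> /allP waitL mayL; case: (may_inv mayL) => [/successful_procs/waitL //|[s step _]].
move eqst: (procs L, C) step => st step.
case: step eqst => [i U P D Di|i U P D] [eqL eqC];
  case: (procs_inv _ eqL) => // L' /perm_mem inL _.
  have /waitL : Act (Put i) U \in L by rewrite inL mem_head.
  by rewrite /= eqC Di.
by have /waitL : Act (Take i) U \in L by rewrite inL mem_head.
Qed.

End Exec.

(** * What correctness demands of the two strings *)

Section TwoWords.
Variables (k : nat) (IS : store k).
Implicit Types (C D : store k) (s r w u v : seq (lock_act k)) (i j l : 'I_k).
Implicit Types (U V : subproc (lock_act k)) (L Q : seq (subproc (lock_act k))).

(** Target behaviour of the tests !✓, !!✓ | ?0, ?0 | (!✓)^(n+1) and !0 | !✓ | ?0 | ?✓. The roles of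
    [s] and [r] differ, so it is later assumed in both orders. *)
Record one_sided_sync s r : Prop := OneSidedSync {
  sync_single : ~ lock_may IS (procs [:: prepend s Tick]);
  sync_double : ~ lock_may IS (procs [:: prepend s (prepend s Tick); prepend r Nil]);
  sync_nseq : forall n, lock_must IS (procs (prepend r Nil :: nseq n.+1 (prepend s Tick)));
  sync_pairs : lock_must IS
    (procs [:: prepend s Nil; prepend s Tick; prepend r Nil; prepend r Tick])
}.

Lemma reach_tick L L' C' : reach L IS L' C' -> Tick \in L' -> lock_may IS (procs L).
Proof.
by move=> reachL tickL'; exists (procs L', C'); split=> //; apply/successful_procs.
Qed.

Lemma no_deadlock L L' C' : lock_must IS (procs L) -> reach L IS L' C' ->
  ~ all (waiting C') L'.
Proof. by move=> mustL /mustL mayL' /waiting_not_may. Qed.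

Lemma single_blocked s r : one_sided_sync s r -> exists l, blocked_on l IS s.
Proof.
case=> single _ _ _; case: (execP IS s) => // [[C execC]]; case: single.
by apply: (reach_tick (reach_exec [::] [::] _ execC)); rewrite mem_head.
Qed.

Definition waits_on i U := if U is Act (Put l) _ then l == i else false.

Lemma waits_on_waiting i C Q : C i -> all (waits_on i) Q -> all (waiting C) Q.
Proof. by move=> Ci; apply: sub_all => -[||[l|l] U] //= /eqP->. Qed.

(* Each time r empties lock i, one of the n copies of s consumes the opening and
   ends up waiting on i. *)
Lemma openings_absorbed i s r C :
    (forall D, D i = false -> blocked_on i D s) -> C i ->
  exists n, forall Q, all (waits_on i) Q -> exists L' C',
    reach (prepend r Nil :: Q ++ nseq n (prepend s Tick)) C L' C' /\
    all (waiting C') L'.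
Proof.
move=> blockS; elim: r C => [|a r IH] C Ci.
  exists 0 => Q waitQ; exists (Nil :: Q), C; rewrite cats0; split; first exact: rt_refl.
  exact: waits_on_waiting waitQ.
have step C1 : exec C [:: a] = Some C1 -> C1 i -> exists n, forall Q, all (waits_on i) Q ->
    exists L' C', reach (prepend (a :: r) Nil :: Q ++ nseq n (prepend s Tick)) C L' C' /\
    all (waiting C') L'.
  move=> stepC C1i; have [n IHn] := IH _ C1i; exists n => Q /IHn[L' [C' [reachL' waitL']]].
  exists L', C'; split=> //; apply: reach_trans reachL'.
  exact: (@reach_exec _ [::] _ [:: a] _ _ _ stepC).
case: a step => l /= step.
  case Cl: (C l) step => step; last by apply: step => //; rewrite ffunE; case: ifP.
  exists 0 => Q waitQ; exists (prepend (Put l :: r) Nil :: Q), C.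
  by rewrite cats0 /= Cl; split; [exact: rt_refl | exact: waits_on_waiting waitQ].
have [eql|neql] := eqVneq i l; last first.
  by apply: step => //; rewrite ffunE (negPf neql).
subst l; case: (blockS (set_cell C i false)); first by rewrite ffunE eqxx.
move=> u [v [C1 [eqs execu C1i]]].
have [n IHn] := IH _ C1i; exists n.+1 => Q waitQ.
case: (IHn (rcons Q (Act (Put i) (prepend v Tick)))) => [|L' [C' [reachL' waitL']]].
  by rewrite all_rcons /= eqxx.
exists L', C'; split=> //; apply: reach_trans reachL'.
apply: reach_trans (@reach_exec _ [::] _ [:: Take i] _ _ _ (erefl _)) _.
rewrite cat_rcons eqs prepend_cat; exact: (reach_exec (_ :: Q)).
Qed.

(** The fullest store with [i] empty: by [exec_mono], a run from it transfers to every store with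
    [i] empty. *)
Definition only_empty i : store k := [ffun l => l != i].

Lemma only_emptyP i C l : C i = false -> C l -> only_empty i l.
Proof. by move=> Ci Cl; rewrite ffunE; apply: contraTneq Cl => ->; rewrite Ci. Qed.

(** The key observation. A first copy of [s], run from [IS], waits on the full lock [i];
    [openings_absorbed] then leads to a deadlock with the other [n] copies. *)
Lemma not_blocked_again i s r : one_sided_sync s r -> blocked_on i IS s ->
  ~ blocked_on i (only_empty i) s.
Proof.
case=> _ _ mustL _ [u0 [v0 [C0 [eqs0 execu0 C0i]]]] [u [v [C [eqs execu Ci]]]].
(* The run before [Put i] fills [i], hence touches it, and so leaves [i] full from [D] as well. *)
have blockS D : D i = false -> blocked_on i D s.
  move=> Di; have [D' execD] := exec_mono (fun l => only_emptyP Di) execu.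
  exists u, v, D'; split=> //; rewrite (exec_cells execu execD).
  case: ifP => // /negbT /(exec_untouched execu).
  by rewrite Ci ffunE eqxx.
have [n absorb] := openings_absorbed r blockS C0i.
case: (absorb [:: Act (Put i) (prepend v0 Tick)]) => [|L' [C' [reachL' waitL']]].
  by rewrite /= eqxx.
apply: (no_deadlock (mustL n) _ waitL'); apply: reach_trans reachL'.
rewrite /= {1}eqs0 prepend_cat; exact: (reach_exec [:: _]).
Qed.

End TwoWords.

(** * Both strings block on the same lock, or both locks start empty *)

Section TwoLocks.
Variable IS : store 2.
Implicit Types (C D : store 2) (s r w u v : seq (lock_act 2)) (i j l : 'I_2).
Local Notation one_sided_sync := (one_sided_sync IS).

Lemma two_locks i j l : i != j -> l = i \/ l = j.
Proof.
by case: i j l => [[|[|?]] ?] [[|[|?]] ?] [[|[|?]] ?] //= _;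
  solve [left; exact: val_inj | right; exact: val_inj].
Qed.

(** Once [s] waits on [i], [r] must not block while [i] is full, so it empties [i] and stops at an
    earlier [Put j]. That [Put j] succeeds from [IS], so [j] was empty there and [s1] fills it. *)
Lemma same_lock_half i j s r s1 s2 C1 r1 r2 C2 : i != j -> one_sided_sync s r ->
    s = s1 ++ Put i :: s2 -> exec IS s1 = Some C1 -> C1 i ->
    r = r1 ++ Put i :: r2 -> exec IS r1 = Some C2 -> C2 i ->
  exists u v C3, [/\ r1 = u ++ Put j :: v, exec IS u = Some C3,
    C3 i = false, C3 j = false & [/\ touches i u, IS j = false & C1 j]].
Proof.
move=> neqij [_ _ /(_ 0) mustL _] eqs execs1 C1i eqr execr1 C2i.
have reach1 : reach [:: prepend r Nil; prepend s Tick] IS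
    [:: prepend r Nil; Act (Put i) (prepend s2 Tick)] C1.
  by rewrite eqs prepend_cat; apply: (reach_exec [:: _] [::]).
have stuck u l v C : r = u ++ Put l :: v -> exec C1 u = Some C -> C l -> C i = false.
  move=> equ execu Cl; apply/negP=> Ci.
  apply: (no_deadlock mustL (reach_trans reach1 _)).
    by rewrite equ prepend_cat; apply: (reach_exec [::] _ _ execu).
  by rewrite /= Cl Ci.
case: (execP C1 r1) => [[C execr1']|[l [u [v [C [equ execu Cl]]]]]].
  have Ci : C i by rewrite (exec_cells execr1 execr1'); case: ifP.
  by move: (stuck _ _ _ _ eqr execr1' Ci); rewrite Ci.
have Ci : C i = false by apply: (stuck u l (v ++ Put i :: r2)) => //; rewrite eqr equ -catA.
have eql : l = j by case: (two_locks l neqij) Cl => // ->; rewrite Ci.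
subst l; exists u, v; move: execr1; rewrite equ exec_cat.
case execu' : (exec IS u) => [C3|] //=; case C3j : (C3 j) => // _; exists C3.
have eqC := exec_cells execu' execu.
have iu : touches i u by apply: contraFT Ci => /negPf ntouch; rewrite eqC ntouch.
have ju : ~~ touches j u by apply/negP=> touchj; move: Cl; rewrite eqC touchj C3j.
split=> //; first by rewrite -Ci eqC iu.
split=> //; first by rewrite -(exec_untouched execu' ju).
by move: Cl; rewrite eqC (negPf ju).
Qed.

(** One half gives a prefix [u] of [r] that leaves both locks empty before a [Put j]. By the other
    half [s1] touches both locks, so after [u] it leaves both full, as from [IS]: a deadlock. *)
Lemma same_lock i j s r : i != j -> one_sided_sync s r -> one_sided_sync r s ->
  blocked_on i IS s -> blocked_on i IS r -> False.
Proof.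
move=> neqij syncs syncr [s1 [s2 [C1 [eqs execs1 C1i]]]] [r1 [r2 [C2 [eqr execr1 C2i]]]].
have [u [v [C3 [equ execu C3i C3j [_ ISj C1j]]]]] :=
  same_lock_half neqij syncs eqs execs1 C1i eqr execr1 C2i.
have [u' [v' [_ [equ' _ _ _ [touchi _ _]]]]] :=
  same_lock_half neqij syncr eqr execr1 C2i eqs execs1 C1i.
have [l C3l|D execs1'] := @exec_mono _ _ C3 _ _ _ execs1.
  by case: (two_locks l neqij) C3l => ->; rewrite ?C3i ?C3j.
have eqD := exec_cells execs1 execs1'.
have Di : D i by rewrite eqD equ' touches_cat touchi.
have Dj : D j by rewrite eqD equ' touches_cat /touches /= inE eqxx !orbT.
case: syncs => _ _ /(_ 0) mustL _.
have waitL : all (waiting D)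
    [:: Act (Put j) (prepend (v ++ Put i :: r2) Nil); Act (Put i) (prepend s2 Tick)].
  by rewrite /= Di Dj.
apply: (no_deadlock mustL _ waitL).
apply: reach_trans (_ : reach _ C3 _ _); last first.
  by apply: (reach_exec [:: _] [::] _ execs1').
rewrite eqr equ -catA prepend_cat eqs [prepend (s1 ++ _) _]prepend_cat.
exact: (reach_exec [::] _ _ execu).
Qed.

(** From [only_empty j], [r] cannot finish, as it does not from the emptier [IS], and cannot block
    on [j]; so it blocks on [i]. *)
Lemma empty_store i j s r : i != j -> one_sided_sync s r -> one_sided_sync r s ->
  blocked_on i IS s -> blocked_on j IS r -> IS i = false -> IS j = false -> False.
Proof.
move=> neqij syncs syncr [s1 [s2 [C1 [eqs execs1 C1i]]]] blockr ISi ISj.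
have leIS D l : IS l -> D l by case: (two_locks l neqij) => ->; rewrite ?ISi ?ISj.
have [[C execr]|[l]] := execP (only_empty j) r.
  have [D] := exec_mono (leIS _) execr; exact: blocked_not_exec blockr.
case: (two_locks l neqij) => ->; last exact: not_blocked_again syncr blockr.
move=> [u [v [C [eqr execu Ci]]]].
have [D execu'] := exec_mono (leIS _) execu.
(* Otherwise [u] would fill [i] from [IS] too, and [r] would block there on [i] instead of [j]. *)
have iu : ~~ touches i u.
  apply/negP=> touchi; case/eqP: neqij; apply: blocked_uniq blockr.
  by exists u, v, D; split; rewrite // (exec_cells execu execu') touchi.
have reach1 : reach [:: prepend r Nil; prepend s Tick] IS
    [:: prepend r Nil; Act (Put i) (prepend s2 Tick)] C1.
  by rewrite eqs prepend_cat; apply: (reach_exec [:: _] [::]).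
have stuck u1 l1 v1 C' :
    r = u1 ++ Put l1 :: v1 -> exec C1 u1 = Some C' -> C' l1 -> C' i -> False.
  move=> equ1 execu1 C'l C'i; case: syncs => _ _ /(_ 0) mustL _.
  apply: (no_deadlock mustL (reach_trans reach1 _)).
    by rewrite equ1 prepend_cat; apply: (reach_exec [::] _ _ execu1).
  by rewrite /= C'l C'i.
(* Lock [i] is full after [s1] and [u] never touches it, so wherever [r] blocks, both strings
   wait. *)
case: (execP C1 u) => [[C' execu1]|[l1 [u1 [v1 [C' [equ execu1 C'l]]]]]].
  have C'i : C' i by rewrite (exec_untouched execu1 iu).
  exact: (stuck _ _ _ _ eqr execu1).
apply: (stuck u1 l1 (v1 ++ Put i :: v) C') => //; first by rewrite eqr equ -catA.
rewrite (exec_untouched execu1) //; apply: contra iu => touchi.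
by rewrite equ touches_cat touchi.
Qed.

End TwoLocks.

(** * Both locks start full *)

Section FullStore.
Variables (IS : store 2) (i j : 'I_2).
Hypotheses (neqij : i != j) (ISi : IS i) (ISj : IS j).
Implicit Types (C D : store 2) (s r w u v : seq (lock_act 2)) (l : 'I_2).
Local Notation one_sided_sync := (one_sided_sync IS).

Let le_store C D : (C i -> D i) -> (C j -> D j) -> forall l, C l -> D l.
Proof. move=> lei lej l; case: (two_locks l neqij) => ->; [exact: lei | exact: lej]. Qed.

Let le_IS C l : C l -> IS l.
Proof. by move=> _; case: (two_locks l neqij) => ->; [exact: ISi | exact: ISj]. Qed.

(** Otherwise [s1] would also fill [i] from [only_empty i], against the key observation. *)
Lemma block_untouched s r s1 s2 C1 : one_sided_sync s r ->
    s = s1 ++ Put i :: s2 -> exec IS s1 = Some C1 -> C1 i -> ~~ touches i s1.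
Proof.
move=> syncs eqs execs1 C1i; apply/negP=> touchi.
have [D execD] := exec_mono (@le_IS (only_empty i)) execs1.
apply: (@not_blocked_again _ _ i _ _ syncs); first by exists s1, s2, C1.
by exists s1, s2, D; split; rewrite // (exec_cells execs1 execD) touchi.
Qed.

Lemma full_store_opened s r s1 s2 C1 r1 r2 C2 :
    one_sided_sync s r -> one_sided_sync r s ->
    s = s1 ++ Put i :: s2 -> exec IS s1 = Some C1 -> C1 i ->
    r = r1 ++ Put j :: r2 -> exec IS r1 = Some C2 -> C2 j ->
    ~~ touches i s1 -> ~~ touches j r1 -> C2 i = false -> False.
Proof.
move=> syncs syncr eqs execs1 C1i eqr execr1 C2j is1 jr1 C2i.
have eqC2 : C2 = only_empty i.
  apply/ffunP=> l; rewrite ffunE; case: (two_locks l neqij) => ->; rewrite ?eqxx ?C2i //.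
  by rewrite C2j eq_sym neqij.
have ir1 : touches i r1.
  by apply: contraFT C2i => ntouch; rewrite (exec_untouched execr1 ntouch).
set q := Put j :: r2.
have js : touches i s by rewrite eqs touches_cat /touches /= inE eqxx orbT.
have jq : touches j q by rewrite /touches /= inE eqxx.
have blocki : blocked_on i IS s by exists s1, s2, C1.
have preq U : prepend r U = prepend r1 (prepend q U) by rewrite eqr prepend_cat.
have [_ _ /(_ 0) mustR _] := syncr.
have reach1 : reach [:: prepend s Nil; prepend r Tick] IS
    [:: prepend s Nil; prepend q Tick] C2.
  by rewrite preq; apply: (reach_exec [:: _] [::]).
(* By the key observation [s] does not block on [i]; a block on [j] would be a deadlock with [q],
   which starts with [Put j]. *)
have [C3 execs] : exists C3, exec C2 s = Some C3.
  case: (execP C2 s) => // [[l [u [v [C [eqs' execu Cl]]]]]].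
  have Cj : C j.
    case: (two_locks l neqij) => eql; subst l => //.
    case: (not_blocked_again syncs blocki).
    by exists u, v, C; rewrite -eqC2.
  case: (no_deadlock mustR (L' := [:: Act (Put l) (prepend v Nil); prepend q Tick]) (C' := C)).
    apply: reach_trans reach1 _; rewrite eqs' prepend_cat.
    exact: (reach_exec [::] _ _ execu).
  by rewrite /= Cl Cj.
have reach3 : reach [:: prepend s Nil; prepend r Tick] IS [:: Nil; prepend q Tick] C3.
  exact: (reach_trans reach1 (reach_exec [::] _ _ execs)).
(* With [s] finished, nothing else can unblock [q]. *)
have C3j : C3 j = false.
  by apply/negP=> C3j; apply: (no_deadlock mustR reach3); rewrite /= C3j.
have [C4 execq] : exists C4, exec C3 q = Some C4.
  case: (execP C3 q) => // [[l [u [v [C [eqq execu Cl]]]]]].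
  case: (no_deadlock mustR (L' := [:: Nil; Act (Put l) (prepend v Tick)]) (C' := C)).
    apply: (reach_trans reach3); rewrite eqq prepend_cat.
    exact: (reach_exec [:: _] [::] _ execu).
  by rewrite /= Cl.
have js' : touches j s.
  by apply: contraFT C3j => ntouch; rewrite (exec_untouched execs ntouch).
case C4j : (C4 j).
  (* If [i] is empty, [C4] is no fuller than [C2], so a second [s] completes. *)
  case C4i : (C4 i); last first.
    have [D execD] : exists D, exec C4 s = Some D.
      by apply: exec_mono execs; apply: le_store; rewrite ?C4i ?C2j.
    have [_ double _ _] := syncs; case: double.
    apply: (reach_tick (L' := [:: Tick; Nil]) (C' := D)) => //.
    rewrite preq.
    apply: reach_trans (reach_exec [:: _] [::] _ execr1) _.
    apply: reach_trans (reach_exec [::] _ _ execs) _.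
    apply: reach_trans (reach_exec [:: _] [::] _ execq) _.
    exact: (reach_exec [::] _ _ execD).
  (* Both locks are full in [C4]. After [s1] and two runs of [r1], the other [s] and one [q]
     complete and leave both locks full again. *)
  have [C5 execr1'] := exec_mono (@le_IS C1) execr1.
  have [C6 execr1''] := exec_mono (@le_IS C5) execr1.
  have C6i : C6 i = false by rewrite (exec_cells execr1 execr1'') ir1.
  have [C7 execs'] : exists C7, exec C6 s = Some C7.
    by apply: exec_mono execs; apply: le_store; rewrite ?C6i ?C2j.
  have C7j : C7 j = false by rewrite (exec_cells execs execs') js'.
  have C7i : C7 i = C3 i by rewrite (exec_cells execs execs') js.
  have [C8 execq'] : exists C8, exec C7 q = Some C8.
    by apply: exec_mono execq; apply: le_store; rewrite ?C7i ?C7j.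
  have C8j : C8 j by rewrite (exec_cells execq execq') jq.
  have C8i : C8 i.
    (* If [q] does not touch [i], then [i] is full in [C3] as in [C4], and [C7] agrees with [C3] on
       [i]. *)
    rewrite (exec_cells execq execq'); case: ifP => // /negbT ntouch.
    by rewrite C7i -(exec_untouched execq ntouch).
  have [_ _ _ mustP] := syncs.
  apply: (no_deadlock mustP
    (L' := [:: Nil; Act (Put i) (prepend s2 Tick); Nil; prepend q Tick]) (C' := C8)).
    rewrite !preq {2}eqs prepend_cat.
    apply: reach_trans (reach_exec [:: _] _ _ execs1) _.
    apply: reach_trans (reach_exec [:: _; _; _] [::] _ execr1') _.
    apply: reach_trans (reach_exec [:: _; _] _ _ execr1'') _.
    apply: reach_trans (reach_exec [::] _ _ execs') _.
    exact: (reach_exec [:: _; _] _ _ execq').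
  by rewrite /= C8i C8j.
(* Now [j] is empty in [C4]. As [r1] opens [i] and does not touch [j], [q] runs as from [C3] and a
   second [r] completes. *)
have [C5 execr1'] := exec_mono (@le_IS C4) execr1.
have C5i : C5 i = false by rewrite (exec_cells execr1 execr1') ir1.
have C5j : C5 j = false by rewrite (exec_untouched execr1' jr1).
have [D execD] : exists D, exec C5 q = Some D.
  by apply: exec_mono execq; apply: le_store; rewrite ?C5i ?C5j.
have [_ double _ _] := syncr; case: double.
apply: (reach_tick (L' := [:: Tick; Nil]) (C' := D)) => //.
rewrite !preq.
apply: reach_trans (reach_exec [::] _ _ execr1) _.
apply: reach_trans (reach_exec [:: _] [::] _ execs) _.
apply: reach_trans (reach_exec [::] _ _ execq) _.
apply: reach_trans (reach_exec [::] _ _ execr1') _.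
exact: (reach_exec [::] _ _ execD).
Qed.

End FullStore.

Lemma full_store (IS : store 2) i j s r : i != j -> IS i -> IS j ->
    one_sided_sync IS s r -> one_sided_sync IS r s ->
  blocked_on i IS s -> blocked_on j IS r -> False.
Proof.
move=> neqij ISi ISj syncs syncr [s1 [s2 [C1 [eqs execs1 C1i]]]].
move=> [r1 [r2 [C2 [eqr execr1 C2j]]]].
have neqji : j != i by rewrite eq_sym.
have is1 := block_untouched neqij ISi ISj syncs eqs execs1 C1i.
have jr1 := block_untouched neqji ISj ISi syncr eqr execr1 C2j.
case C2i : (C2 i); last first.
  exact: (full_store_opened neqij ISi ISj syncs syncr eqs execs1 _ eqr execr1).
case C1j : (C1 j); last first.
  exact: (full_store_opened neqji ISj ISi syncr syncs eqr execr1 _ eqs execs1).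
(* Here [s1] and [r1] each leave both locks full, hence so does [s1] followed by [r1]. *)
have [l _|C execr1'] := @exec_mono _ _ C1 _ _ _ execr1.
  by case: (two_locks l neqij) => ->.
case: syncs => _ _ /(_ 0) mustL _.
apply: (no_deadlock mustL
  (L' := [:: Act (Put j) (prepend r2 Nil); Act (Put i) (prepend s2 Tick)]) (C' := C)).
  rewrite eqs eqr !prepend_cat.
  apply: reach_trans (reach_exec [:: _] [::] _ execs1) _.
  exact: (reach_exec [::] _ _ execr1').
by rewrite /= !(exec_cells execr1 execr1') C2i C2j C1i C1j !if_same.
Qed.

(** * Case analysis on the initial store, and the conclusion for translations *)

Lemma no_sync_with_two_locks (IS : store 2) s r :
  one_sided_sync IS s r -> one_sided_sync IS r s -> False.
Proof.
move=> syncs syncr.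
have [i blocks] := single_blocked syncs; have [j blockr] := single_blocked syncr.
have [eqij|neqij] := eqVneq i j.
  subst j; have [j neqij] : exists j, i != j.
    exists (inord (1 - i)).
    by case: i {blocks blockr} => [[|[|?]] ?] //; rewrite -val_eqE /= inordK.
  exact: (same_lock neqij syncs syncr).
have neqji : j != i by rewrite eq_sym.
(* With exactly one lock empty, [IS] is [only_empty] of a lock on which a string blocks from [IS],
   against the key observation. *)
have eq_only_empty l m : l != m -> IS l = false -> IS m -> IS = only_empty l.
  move=> neqlm ISl ISm; apply/ffunP => n; rewrite ffunE.
  by case: (two_locks n neqlm) => ->; rewrite ?eqxx // ISm eq_sym neqlm.
case ISi : (IS i); case ISj : (IS j).
- exact: (full_store neqij ISi ISj syncs syncr).
- by apply: (not_blocked_again syncr blockr); rewrite -(eq_only_empty j i).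
- by apply: (not_blocked_again syncs blocks); rewrite -(eq_only_empty i j).
- exact: (empty_store neqij syncs syncr).
Qed.

(** May-convergence is reflected from the target for the first two tests, must-convergence carried
    to it for the others. Indexing the strings by actions yields both orders of the roles. *)
Lemma correct_one_sided_sync (k : nat) (IS : store k) tau : compositional tau ->
  correct IS tau -> exists w, forall a, one_sided_sync IS (w a) (w (dual a)).
Proof.
move=> [ws [wr [t [taut [tNil [tTick [tSend [tRecv tauD]]]]]]]] corr.
pose w a := if a is Send then ws else wr.
have tAct a U : t (Act a U) = prepend (w a) (t U) by case: a.
have tau_procs L : tau (procs L) = procs (map t L).
  elim: L => [|U L IH] /=; last by rewrite tauD taut IH.
  by rewrite -proc_of_Nil taut tNil proc_of_Nil.
have may L : lock_may IS (procs (map t L)) -> sync_may (procs L).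
  by rewrite -tau_procs; case: (corr (procs L)) => -[].
have must L : sync_must (procs L) -> lock_must IS (procs (map t L)).
  by rewrite -tau_procs; case: (corr (procs L)) => _ [].
exists w => a; split.
- by move=> mayL; apply: (@sync_single_not_may a Tick); apply: may; rewrite /= tAct tTick.
- by move=> mayL; apply: (@sync_double_not_may a); apply: may; rewrite /= !tAct tNil tTick.
- by move=> n; have := must _ (@sync_must_nseq a n); rewrite /= map_nseq !tAct tNil tTick.
- by have := must _ (@sync_must_two_pairs a); rewrite /= !tAct tNil tTick.
Qed.

Theorem theorem5p17 (IS : store 2) (tau : sync_proc -> lock_proc 2) :
  compositional tau -> ~ correct IS tau.
Proof.
move=> comp corr; have [w sync] := correct_one_sided_sync comp corr.
exact: no_sync_with_two_locks (sync Send) (sync Recv).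
Qed.
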